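(* Let $n$ be a positive integer and let $T\colon M_n \rightarrow M_n$ be linear. If $T$ preserves Hadamard circulant majorization, then so does its Moore-Penrose inverse $T^{\dagger}$.
   Context: $M_n$ is the real vector space of all $n\times n$ real matrices, equipped with the inner product $\langle X,Y\rangle:=\operatorname{trace}(XY^\top)$, and $\mathbb{N}_n=\{1,\ldots,n\}$. Let $C:=[\mathbf{e}_n,\mathbf{e}_1,\ldots,\mathbf{e}_{n-1}]$ be the $n\times n$ matrix with the indicated columns, where $\mathbf{e}_i$ is the $i$th standard basis vector of $\mathbb{R}^n$; for $i\in\mathbb{N}_n$ put $C_i:=C^i$ (the $i$th power). A matrix in $M_n$ is called circulant doubly stochastic if it is a convex combination of $C_1,\ldots,C_n$. For $X=[x_{ij}],Y=[y_{ij}]\in M_n$, the Hadamard product is $X\odot Y:=[x_{ij}y_{ij}]$. We write $X\prec_{HC}Y$ ($X$ is Hadamard circulant majorized by $Y$) if there is a circulant doubly stochastic matrix $D\in M_n$ with $X=D\odot Y$. A linear operator $T\colon M_n\to M_n$ preserves Hadamard circulant majorization if $T(X)\prec_{HC}T(Y)$ whenever $X\prec_{HC}Y$. For a linear operator $T\colon M_n\to M_n$, $T^*$ denotes its adjoint with respect to the inner product above. The Moore-Penrose inverse $T^\dagger$ is the unique linear operator $X\colon M_n\to M_n$ satisfying $TXT=T$, $XTX=X$, $(TX)^*=TX$ and $(XT)^*=XT$. *)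

(* Defs.v *)
From HB Require Import structures.
From mathcomp Require Import all_boot all_order all_algebra.
From mathcomp Require Import boolp classical_sets reals.

Set Implicit Arguments.
Unset Strict Implicit.
Unset Printing Implicit Defensive.

Import Order.TTheory GRing.Theory Num.Theory.
Local Open Scope ring_scope.

Section HadamardCirculantMajorization.
Variables (R : realType) (n : nat).
Implicit Types X Y D : 'M[R]_n.

(* Indices are 0-based: column j is the standard basis vector of index
   j - 1 modulo n, so the columns are e_n, e_1, ..., e_(n-1). *)
Definition circ_shift : 'M[R]_n := \matrix_(i, j) (i == ord_pred j)%:R.

(* The exponents i.+1, for i : 'I_n, range over 1, ..., n. *)
Definition circulant_doubly_stochastic D : Prop :=
  exists a : 'I_n -> R,
    [/\ forall i, 0 <= a i, \sum_i a i = 1 &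
        D = \sum_i a i *: circ_shift ^+ i.+1].

(* [map2_mx *%R D Y] is the Hadamard product of D and Y. *)
Definition hc_majorized X Y : Prop :=
  exists2 D, circulant_doubly_stochastic D & X = map2_mx *%R D Y.

Definition preserves_hc_majorization (T : 'End('M[R]_n)) : Prop :=
  forall X Y, hc_majorized X Y -> hc_majorized (T X) (T Y).

End HadamardCirculantMajorization.

Section MoorePenrose.
Variables (R : realType) (n : nat).
Implicit Types (X Y : 'M[R]_n) (S T U : 'End('M[R]_n)).

Definition mxdot X Y : R := \tr (X *m Y^T).

Lemma mxdotE X Y : mxdot X Y = \sum_i \sum_j X i j * Y i j.
Proof.
by apply: eq_bigr => i _; rewrite mxE; apply: eq_bigr => j _; rewrite mxE.
Qed.

Lemma mxdotDl X1 X2 Y : mxdot (X1 + X2) Y = mxdot X1 Y + mxdot X2 Y.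
Proof. by rewrite /mxdot mulmxDl mxtraceD. Qed.

Lemma mxdotZl a X Y : mxdot (a *: X) Y = a * mxdot X Y.
Proof. by rewrite /mxdot -scalemxAl mxtraceZ. Qed.

Lemma mxdot_suml (I : finType) (F : I -> 'M[R]_n) Y :
  mxdot (\sum_i F i) Y = \sum_i mxdot (F i) Y.
Proof. by rewrite /mxdot mulmx_suml raddf_sum. Qed.

Lemma mxdotC X Y : mxdot X Y = mxdot Y X.
Proof.
by rewrite !mxdotE; apply: eq_bigr => i _; apply: eq_bigr => j _; rewrite mulrC.
Qed.

Lemma mxdot_delta i j Y : mxdot (delta_mx i j) Y = Y i j.
Proof.
rewrite mxdotE (bigD1 i) //= (bigD1 j) //= mxE !eqxx mul1r.
rewrite big1 ?addr0 => [|k /negPf kj]; last by rewrite mxE kj andbF mul0r.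
rewrite big1 ?addr0 // => k /negPf ki.
by rewrite big1 // => l _; rewrite mxE ki mul0r.
Qed.

Lemma mxdot_inj X Y : (forall Z, mxdot Z X = mxdot Z Y) -> X = Y.
Proof. by move=> XY; apply/matrixP => i j; rewrite -!mxdot_delta XY. Qed.

Definition adjoint_fun T Y : 'M[R]_n :=
  \matrix_(i, j) mxdot (T (delta_mx i j)) Y.

Fact adjoint_fun_is_linear T : linear (adjoint_fun T).
Proof.
move=> a X Y; apply/matrixP => i j; rewrite !mxE !(mxdotC (T _)).
by rewrite mxdotDl mxdotZl.
Qed.

HB.instance Definition _ T :=
  GRing.isLinear.Build R 'M[R]_n 'M[R]_n _ (adjoint_fun T)
    (adjoint_fun_is_linear T).

Definition adjoint T : 'End('M[R]_n) := linfun (adjoint_fun T).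

Lemma adjointP T X Y : mxdot (T X) Y = mxdot X (adjoint T Y).
Proof.
rewrite lfunE /= [in LHS](matrix_sum_delta X) linear_sum mxdot_suml mxdotE.
apply: eq_bigr => i _; rewrite linear_sum mxdot_suml; apply: eq_bigr => j _.
by rewrite linearZ mxdotZl [in RHS]mxE.
Qed.

Lemma adjoint_unique T S :
  (forall X Y, mxdot (T X) Y = mxdot X (S Y)) -> adjoint T = S.
Proof.
move=> TS; apply/lfunP => Y; apply: mxdot_inj => X.
by rewrite -adjointP TS.
Qed.

Lemma adjoint_comp S T : adjoint (S \o T)%VF = (adjoint T \o adjoint S)%VF.
Proof. by apply: adjoint_unique => X Y; rewrite !comp_lfunE !adjointP. Qed.

Definition is_moore_penrose T U : Prop :=
  [/\ (T \o U \o T)%VF = T, (U \o T \o U)%VF = U,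
      adjoint (T \o U)%VF = (T \o U)%VF & adjoint (U \o T)%VF = (U \o T)%VF].

Definition moore_penrose T : 'End('M[R]_n) :=
  xget 0 [set U | is_moore_penrose T U]%classic.

Lemma is_moore_penrose_unique T U1 U2 :
  is_moore_penrose T U1 -> is_moore_penrose T U2 -> U1 = U2.
Proof.
move=> [a1 b1 c1 d1] [a2 b2 c2 d2].
have TU : (T \o U1)%VF = (T \o U2)%VF.
  rewrite -c1 -[X in (X \o U1)%VF]a2 -comp_lfunA adjoint_comp c1 c2.
  by rewrite comp_lfunA a1.
have UT : (U1 \o T)%VF = (U2 \o T)%VF.
  rewrite -d1 -[X in (U1 \o X)%VF]a2 -comp_lfunA comp_lfunA adjoint_comp d1 d2.
  by rewrite -comp_lfunA [(T \o _)%VF]comp_lfunA a1.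
by rewrite -b1 UT -comp_lfunA TU comp_lfunA b2.
Qed.

Lemma gram_unit m p (A : 'M[R]_(m, p)) : row_free A -> A *m A^T \in unitmx.
Proof.
move=> Afree; rewrite -row_free_unit -kermx_eq0; apply/eqP/row_matrixP => i.
rewrite row0; set v := row i _.
have vA : v *m (A *m A^T) = 0 by rewrite -row_mul mulmx_ker row0.
have w0 : (v *m A) *m (v *m A)^T = 0.
  by rewrite trmx_mul mulmxA -[_ *m A *m _]mulmxA vA mul0mx.
apply: (row_free_inj Afree); rewrite mul0mx; apply/rowP => j.
move/matrixP/(_ 0 0): w0; rewrite mxE [RHS]mxE => /eqP.
rewrite psumr_eq0; last by move=> k _; rewrite [_^T _ _]mxE -expr2 sqr_ge0.
by move=> /allP/(_ j (mem_index_enum _)); rewrite [_^T _ _]mxE mulf_eq0 orbb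
  => /eqP ->; rewrite mxE.
Qed.

Lemma mx_moore_penrose_exists p (A : 'M[R]_p) :
  exists G, [/\ A *m G *m A = A, G *m A *m G = G,
                (A *m G)^T = A *m G & (G *m A)^T = G *m A].
Proof.
have [r [B [C [AE Bfull Cfree]]]] : exists r (B : 'M[R]_(p, r)) (C : 'M_(r, p)),
    [/\ A = B *m C, row_full B & row_free C].
  exists (\rank A), (col_base A), (row_base A).
  by rewrite mulmx_base col_base_full row_base_free.
have uC : C *m C^T \in unitmx by exact: gram_unit.
have uB : B^T *m B \in unitmx.
  rewrite -{2}[B]trmxK; apply: gram_unit.
  by rewrite /row_free mxrank_tr.
set P := invmx (C *m C^T); set Q := invmx (B^T *m B).
have PT : P^T = P by rewrite /P trmx_inv trmx_mul trmxK.
have QT : Q^T = Q by rewrite /Q trmx_inv trmx_mul trmxK.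
exists (C^T *m P *m Q *m B^T).
have AG : A *m (C^T *m P *m Q *m B^T) = B *m Q *m B^T.
  rewrite AE !mulmxA -[B *m C *m _]mulmxA.
  by rewrite -[B *m _ *m P]mulmxA mulmxV // mulmx1.
have GA : (C^T *m P *m Q *m B^T) *m A = C^T *m P *m C.
  rewrite AE -!mulmxA [B^T *m _]mulmxA.
  by rewrite [Q *m _]mulmxA mulVmx // mul1mx.
split.
- rewrite AG AE -!mulmxA [B^T *m _]mulmxA.
  by rewrite [Q *m _]mulmxA mulVmx // mul1mx.
- rewrite GA !mulmxA -[_ *m C *m C^T]mulmxA -[_ *m (C *m C^T) *m P]mulmxA.
  by rewrite mulmxV // mulmx1.
- by rewrite AG !trmx_mul trmxK QT mulmxA.
- by rewrite GA !trmx_mul trmxK PT mulmxA.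
Qed.

Lemma mxdot_mxvec X Y : mxdot X Y = (mxvec X *m (mxvec Y)^T) 0 0.
Proof.
rewrite mxdotE mxE pair_bigA (reindex _ (curry_mxvec_bij n n)) /=.
by apply: eq_bigr => -[i j] _ /=; rewrite mxE !mxvecE.
Qed.

Lemma is_moore_penrose_exists T : exists U, is_moore_penrose T U.
Proof.
have [G [G1 G2 G3 G4]] := mx_moore_penrose_exists (lin_mx T).
pose U : 'End('M[R]_n) := linfun (vec_mx \o mulmxr G \o mxvec).
have TE X : mxvec (T X) = mxvec X *m lin_mx T by rewrite mul_vec_lin.
have UE X : mxvec (U X) = mxvec X *m G by rewrite lfunE /= vec_mxK.
have sa (S : 'End('M[R]_n)) M :
    (forall X, mxvec (S X) = mxvec X *m M) -> M^T = M -> adjoint S = S.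
  move=> SE MT; apply: adjoint_unique => X Y.
  by rewrite !mxdot_mxvec !SE trmx_mul MT mulmxA.
exists U; split.
- apply/lfunP => X; apply: (can_inj mxvecK).
  by rewrite !comp_lfunE !TE UE TE -!mulmxA [lin_mx T *m _]mulmxA G1.
- apply/lfunP => X; apply: (can_inj mxvecK).
  by rewrite !comp_lfunE !UE TE UE -!mulmxA [G *m _]mulmxA G2.
- by apply: (sa _ (G *m lin_mx T)) => // X; rewrite comp_lfunE TE UE mulmxA.
- by apply: (sa _ (lin_mx T *m G)) => // X; rewrite comp_lfunE UE TE mulmxA.
Qed.

Lemma moore_penroseP T : is_moore_penrose T (moore_penrose T).
Proof. by have [U TU] := is_moore_penrose_exists T; exact: (xgetI 0 TU). Qed.

End MoorePenrose.

(* Main.v *)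
Require Import Defs.
From HB Require Import structures.
From mathcomp Require Import all_boot all_order all_fingroup all_algebra.
From mathcomp Require Import boolp reals.
From mathcomp Require Import zify lra.

(** Hadamard multiplication by [C_k] is the orthogonal projection [P_k] onto
    the matrices supported on the [k]-th circulant diagonal, and [X] is
    majorized by [Y] iff [X] is a convex combination of the [P_k Y].  The
    operator [T] preserves majorization iff there is a permutation [s] with
    [T P_k = P_(s k) T] for all [k]: comparing [T (P_k Y)] with [T Y] shows that
    the block matrix [(P_m T P_k)] has at most one nonzero block in each row
    and in each column, and the resulting partial matching extends to a
    permutation.  Such intertwining relations between self-adjoint operators
    pass to the Moore-Penrose inverse, with [s] replaced by its inverse. *)

Set Implicit Arguments.
Unset Strict Implicit.
Unset Printing Implicit Defensive.

Import Order.TTheory GRing.Theory Num.Theory.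
Local Open Scope ring_scope.

Lemma partial_injection_extends (I : finType) (r : rel I) :
    (forall x y z, r x y -> r x z -> y = z) ->
    (forall x y z, r x z -> r y z -> x = y) ->
  exists s : {perm I}, forall x y, r x y -> s x = y.
Proof.
(* A permutation agreeing with [r] at the most points: a violated constraint
   could be repaired by a transposition without breaking any other. *)
move=> rfun rinj; pose A (s : {perm I}) := [set x | r x (s x)].
case: (@arg_maxnP _ 1%g xpredT (fun s => #|A s|) isT) => s _ smax.
exists s => x y rxy; apply/eqP; apply: contraT => sxy.
move: (smax (s * tperm (s x) y)%g isT); apply: contraLR => _; rewrite -ltnNge.
apply: proper_card; apply/properP; split.
  apply/subsetP => z; rewrite !inE permM => rz.
  case: tpermP => [/perm_inj zx | szy | _ _] //; first by rewrite zx.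
  rewrite szy in rz; rewrite (rinj _ _ _ rz rxy) in szy.
  by rewrite szy eqxx in sxy.
exists x; rewrite inE ?permM ?tpermL //.
by apply: contra sxy => /rfun/(_ rxy) ->.
Qed.

Section MoorePenroseIntertwining.
Variables (R : realType) (n : nat).
Implicit Types (T U A B : 'End('M[R]_n)).

(** The relation makes the range of [T] stable under [B] and its kernel stable under [A]. For
    self-adjoint [A] and [B], the orthogonal projections [TU] and [UT] then commute with [B] and
    [A], so [UB = UTUB = UBTU = UTAU = AUTU = AU]. *)
Lemma moore_penrose_intertwines T U A B :
    is_moore_penrose T U -> adjoint A = A -> adjoint B = B ->
  (T \o A = B \o T)%VF -> (U \o B = A \o U)%VF.
Proof.
case=> TUT UTU TUa UTa Aa Ba TA.
have adjSBS S B' : adjoint S = S -> adjoint B' = B' ->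
    adjoint (S \o B' \o S) = (S \o B' \o S)%VF.
  by move=> Sa B'a; rewrite !adjoint_comp Sa B'a comp_lfunA.
have BTU : (B \o (T \o U) = T \o U \o B \o (T \o U))%VF.
  rewrite !comp_lfunA -[(_ \o B \o T)%VF]comp_lfunA -TA.
  by rewrite comp_lfunA TUT.
(* By [BTU], [B \o (T \o U)] is self-adjoint; its adjoint is [T \o U \o B]. *)
have TUB : (T \o U \o B = B \o (T \o U))%VF.
  by rewrite -[in LHS]TUa -[in LHS]Ba -adjoint_comp BTU adjSBS.
have UTA' : (U \o T \o A = U \o T \o A \o (U \o T))%VF.
  rewrite -[(U \o T \o A)%VF]comp_lfunA TA -!comp_lfunA.
  by rewrite [(T \o (U \o T))%VF]comp_lfunA TUT.
have UTA : (U \o T \o A = A \o (U \o T))%VF.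
  by rewrite -[in RHS]UTa -[in RHS]Aa -adjoint_comp UTA' adjSBS.
rewrite -[in LHS]UTU -[in LHS]comp_lfunA -[in LHS]comp_lfunA.
rewrite [X in (U \o X)%VF]comp_lfunA TUB [X in (U \o X)%VF]comp_lfunA -TA.
rewrite [LHS]comp_lfunA [X in (X \o U)%VF]comp_lfunA UTA.
by rewrite -!comp_lfunA [X in (A \o X)%VF]comp_lfunA UTU.
Qed.

End MoorePenroseIntertwining.

Section CirculantDiagonals.
Variables (R : realType) (n : nat).
Implicit Types (X Y Z : 'M[R]_n) (T : 'End('M[R]_n)).

(* The [k : 'I_n] such that [C_(k.+1)] has a nonzero [(i, j)] entry, namely
   [j - i - 1] modulo [n]. *)
Definition diag_index (i j : 'I_n) : 'I_n :=
  Ordinal (ltn_pmod (j + (n - i.+1)) (leq_ltn_trans (leq0n i) (ltn_ord i))).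

Lemma circ_shift_expE k (i j : 'I_n) :
  (circ_shift R n ^+ k) i j = ((i + k) %% n == j)%N%:R.
Proof.
elim: k j => [|k IHk] j.
  by rewrite expr0 mxE addn0 modn_small.
rewrite exprSr mxE (bigD1 (ord_pred j)) //= big1 => [|l lj]; last first.
  by rewrite [circ_shift _ _ _ _]mxE (negPf lj) mulr0.
rewrite addr0 IHk [circ_shift _ _ _ _]mxE eqxx mulr1; congr (nat_of_bool _)%:R.
have n0 := leq_ltn_trans (leq0n i) (ltn_ord i).
pose m : 'I_n := Ordinal (ltn_pmod (i + k) n0).
have -> : ((i + k.+1) %% n)%N = ordS m.
  by rewrite addnS /= -[in RHS]addn1 modnDml addn1.
change (m == ord_pred j = (val (ordS m) == j)); rewrite (inj_eq val_inj).
by rewrite -(inj_eq (can_inj (@ordSK n))) ord_predK.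
Qed.

Lemma circ_shift_exp_diag (i j k : 'I_n) :
  (circ_shift R n ^+ k.+1) i j = (diag_index i j == k)%:R.
Proof.
rewrite circ_shift_expE -[_ == k]/((j + (n - i.+1)) %% n == k)%N.
(* Both dividends lie below [n + n], so each remainder takes at most one subtraction of [n]. *)
have modE m : (m < n + n)%N -> (m %% n = if m < n then m else m - n)%N.
  move=> m2n; case: ltnP => [/modn_small //|nm].
  by rewrite -{1}(subnK nm) modnDr modn_small // ltn_subLR.
have := (ltn_ord i, ltn_ord j, ltn_ord k) => -[[iltn jltn] kltn].
rewrite !modE; [|lia|lia].
congr (nat_of_bool _)%:R; apply/eqP/eqP; case: ltnP => ?; case: ltnP => ?; lia.
Qed.

(** The powers of [circ_shift] have disjoint supports covering all entries, so the convex weights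
    are themselves the entries of [D]. *)
Lemma hc_majorizedP X Y :
  hc_majorized X Y <->
  exists a : 'I_n -> R, [/\ forall k, 0 <= a k, \sum_k a k = 1 &
    forall i j, X i j = a (diag_index i j) * Y i j].
Proof.
have DE (a : 'I_n -> R) i j :
    (\sum_k a k *: circ_shift R n ^+ k.+1) i j = a (diag_index i j).
  rewrite summxE; under eq_bigr do rewrite mxE circ_shift_exp_diag.
  rewrite (bigD1 (diag_index i j)) //= eqxx mulr1 big1 ?addr0 // => k /negPf ki.
  by rewrite eq_sym ki mulr0.
split=> [[D [a [a0 a1 ->]] ->]|[a [a0 a1 XE]]].
  by exists a; split=> // i j; rewrite mxE DE.
exists (\sum_k a k *: circ_shift R n ^+ k.+1); first by exists a.
by apply/matrixP => i j; rewrite mxE DE XE.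
Qed.

Definition diag_proj_fun (k : 'I_n) Y : 'M[R]_n :=
  \matrix_(i, j) ((diag_index i j == k)%:R * Y i j).

Fact diag_proj_fun_is_linear k : linear (diag_proj_fun k).
Proof.
by move=> a X Y; apply/matrixP => i j; rewrite !mxE mulrDr mulrCA.
Qed.

HB.instance Definition _ k :=
  GRing.isLinear.Build R 'M[R]_n 'M[R]_n _ (diag_proj_fun k)
    (diag_proj_fun_is_linear k).

Definition diag_proj k : 'End('M[R]_n) := linfun (diag_proj_fun k).

Lemma diag_projE k Y i j :
  diag_proj k Y i j = (diag_index i j == k)%:R * Y i j.
Proof. by rewrite lfunE mxE. Qed.

Lemma sum_diag_proj Y : \sum_k diag_proj k Y = Y.
Proof.
apply/matrixP => i j; rewrite summxE (bigD1 (diag_index i j)) //=.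
rewrite diag_projE eqxx mul1r big1 ?addr0 // => k /negPf ki.
by rewrite diag_projE eq_sym ki mul0r.
Qed.

Lemma diag_projK k l Y :
  diag_proj k (diag_proj l Y) = if k == l then diag_proj k Y else 0.
Proof.
apply/matrixP => i j; rewrite !diag_projE.
case: (eqVneq k l) => [<-|kl].
  by rewrite diag_projE mulrA -natrM mulnb andbb.
rewrite mxE; case: eqP => [->|_]; last by rewrite mul0r.
by rewrite (negPf kl) mul0r mulr0.
Qed.

Lemma adjoint_diag_proj k : adjoint (diag_proj k) = diag_proj k.
Proof.
apply: adjoint_unique => X Y; rewrite !mxdotE.
by apply: eq_bigr => i _; apply: eq_bigr => j _;
  rewrite !diag_projE mulrCA mulrA.
Qed.

Lemma preserves_diag_proj T k Y : preserves_hc_majorization T ->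
  exists b : 'I_n -> R, [/\ forall m, 0 <= b m, \sum_m b m = 1 &
    forall i j, T (diag_proj k Y) i j = b (diag_index i j) * T Y i j].
Proof.
move=> Tpres; apply/hc_majorizedP/Tpres/hc_majorizedP.
(* A vertex of the simplex of weights: [diag_proj k Y] is majorized by [Y]. *)
exists (fun l => (l == k)%:R); split=> [l||i j]; first exact: ler0n.
  by rewrite (bigD1 k) //= eqxx big1 ?addr0 // => l /negPf ->.
exact: diag_projE.
Qed.

Definition nonzero_block T k m :=
  exists Y i j, diag_index i j = m /\ T (diag_proj k Y) i j != 0.

Lemma nonzero_block_row T k l m : preserves_hc_majorization T ->
  nonzero_block T k m -> nonzero_block T l m -> k = l.
Proof.
move=> Tpres [Y [i [j [<- u0]]]] [Z [i' [j' [ijE w0]]]].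
apply/eqP; apply: contraT => kl.
(* Majorization of [T (P_k W)] by [T W] for [W = P_k Y + s P_l Z]; the choice
   [s = - u / w] below makes an entry of [T W] vanish where [T (P_k W)] does
   not. *)
have bP s : exists c : R,
    T (diag_proj k Y) i j
      = c * (T (diag_proj k Y) i j + s * T (diag_proj l Z) i j) /\
    T (diag_proj k Y) i' j'
      = c * (T (diag_proj k Y) i' j' + s * T (diag_proj l Z) i' j').
  have [b [_ _ bE]] :=
    preserves_diag_proj k (diag_proj k Y + s *: diag_proj l Z) Tpres.
  move: bE; rewrite linearD linearZ /= !diag_projK eqxx (negPf kl) scaler0.
  rewrite addr0 => bE; exists (b (diag_index i j)).
  by split; [rewrite [LHS]bE | rewrite [LHS]bE ijE];
    rewrite linearD linearZ !mxE.
move: u0 w0 bP; set u := T _ i j; set w := T _ i j; set u' := T _ i' j'.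
set w' := T _ i' j' => u0 w'0 bP.
(* If [w = 0], the first entry forces [c = 1]; both entries lie on the same diagonal and share [c],
   so [w' = 0]. *)
case: (eqVneq w 0) => [wz|w0].
  have [c [uE u'E]] := bP 1; rewrite wz mulr0 addr0 in uE.
  have c1 : c = 1 by apply: (mulIf u0); rewrite mul1r -uE.
  by case/eqP: w'0; move: u'E; rewrite c1; lra.
by have [c []] := bP (- (u / w)); rewrite mulNr divfK // subrr mulr0 => /eqP;
  rewrite (negPf u0).
Qed.

Lemma nonzero_block_col T k m p : preserves_hc_majorization T ->
  nonzero_block T k m -> nonzero_block T k p -> m = p.
Proof.
move=> Tpres [Y [i [j [ijE u0]]]] [Z [i' [j' [ijE' w0]]]].
apply/eqP; apply: contraT => mp.
(* One of [Y], [Z] and [Y + Z] serves. *)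
have [W W0 W'0] : exists2 W, T (diag_proj k W) i j != 0 &
    T (diag_proj k W) i' j' != 0.
  case: (eqVneq (T (diag_proj k Y) i' j') 0) => [Y0|]; last by exists Y.
  case: (eqVneq (T (diag_proj k Z) i j) 0) => [Z0|]; last by exists Z.
  by exists (Y + Z); rewrite !linearD !mxE ?Y0 ?Z0 ?addr0 ?add0r.
have [b [b0 b1 bE]] := preserves_diag_proj k (diag_proj k W) Tpres.
(* For [W] in the range of [P_k], [T W] is majorized by itself through [b], which
   forces [b m = b p = 1]. *)
have bone i1 j1 : T (diag_proj k W) i1 j1 != 0 -> b (diag_index i1 j1) = 1.
  move=> t0; apply: (mulIf t0); rewrite mul1r -bE.
  by rewrite diag_projK eqxx.
move: b1; rewrite (bigD1 m) //= (bigD1 p) 1?eq_sym //=.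
rewrite -{1}ijE -{1}ijE' !bone //.
have : 0 <= \sum_(q | (q != m) && (q != p)) b q by exact: sumr_ge0.
lra.
Qed.

Lemma preserves_hc_majorizationP T :
  preserves_hc_majorization T <->
  exists s : {perm 'I_n},
    forall k, (T \o diag_proj k = diag_proj (s k) \o T)%VF.
Proof.
split=> [Tpres|[s Ts] X Y /hc_majorizedP[a [a0 a1 XE]]]; last first.
  (* The weight of diagonal [k] moves with it to diagonal [s k]. *)
  apply/hc_majorizedP; exists (fun m => a ((s^-1)%g m)); split=> // [|i j].
    by rewrite -a1 [RHS](reindex_inj (@perm_inj _ (s^-1)%g)).
  have -> : X = \sum_k a k *: diag_proj k Y.
    apply/matrixP => i1 j1; rewrite XE -{1}[Y]sum_diag_proj !summxE mulr_sumr.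
    apply: eq_bigr => k _; rewrite [RHS]mxE diag_projE.
    by case: eqP => [->//|_]; rewrite mul0r !mulr0.
  rewrite linear_sum summxE (bigD1 ((s^-1)%g (diag_index i j))) //=.
  rewrite big1 ?addr0 => [|k ks];
    rewrite linearZ /= mxE -comp_lfunE Ts comp_lfunE.
    by rewrite diag_projE permKV eqxx mul1r.
  move: ks; rewrite diag_projE -(inj_eq (@perm_inj _ s)) permKV eq_sym.
  by move=> /negPf ->; rewrite mul0r mulr0.
have [||s sP] := @partial_injection_extends _
    (fun k m => `[< nonzero_block T k m >]).
- by move=> k m p /asboolP + /asboolP; exact: nonzero_block_col.
- by move=> k l m /asboolP + /asboolP; exact: nonzero_block_row.
have T0 k Y i j : s k != diag_index i j -> T (diag_proj k Y) i j = 0.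
  move=> sk; apply/eqP; apply: contraT => t0; case/eqP: sk.
  by apply: sP; apply/asboolP; exists Y, i, j.
exists s => k; apply/lfunP => Y; rewrite !comp_lfunE; apply/matrixP => i j.
(* As [s] is injective, only the [k]-th summand of [Y] contributes to [T Y] on diagonal [s k]. *)
rewrite diag_projE; case: (eqVneq (s k) (diag_index i j)) => [sk|sk].
  rewrite mul1r -{2}[Y]sum_diag_proj linear_sum summxE (bigD1 k) //=.
  by rewrite big1 ?addr0 // => l lk; rewrite T0 // -sk (inj_eq perm_inj).
by rewrite mul0r T0.
Qed.

End CirculantDiagonals.

Theorem theorem2p9 (R : realType) (n : nat) (hn : (0 < n)%N)
    (T : 'End('M[R]_n)) :
  preserves_hc_majorization T -> preserves_hc_majorization (moore_penrose T).
Proof.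
move=> /preserves_hc_majorizationP[s Ts]; apply/preserves_hc_majorizationP.
exists (s^-1)%g => m.
apply: (moore_penrose_intertwines (moore_penroseP T));
  [exact: adjoint_diag_proj.. | by rewrite Ts permKV].
Qed.
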